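(* Let $A=(a_{ij})_{n\times n}$ be a real matrix with nonnegative entries, $L=\mathrm{diag}(A\mathbf 1)-A$, $\delta>0$, and $K=I-E$, where $E=\tfrac1n\mathbf 1\mathbf 1^{\mathrm T}$. If $\boldsymbol{x}(t)$ is the solution to the system of equations $\dot{\boldsymbol{x}}(t)=-(L+\delta K)\,\boldsymbol{x}(t)$, $t\ge0$, then 1. $\displaystyle\lim_{t\to\infty}\boldsymbol{x}(t)=\mathbf 1\,\tfrac1n\sum_{j=1}^n s_j^\delta\,x_j(0)$, where $s_j^\delta$, $j=1,\ldots,n$, are the column sums of $\big(I+\tfrac1\delta L\big)^{-1}$; 2. $\displaystyle\lim_{\delta\to+0}\lim_{t\to\infty}\boldsymbol{x}(t)=\mathbf 1\,\tfrac1n\sum_{j=1}^n\bar J_{\cdot j}\,x_j(0)$, where the initial state $\boldsymbol{x}(0)$ is fixed independently of $\delta$, $\bar J_{\cdot j}=\sum_{i=1}^n\bar J_{ij}$, $j=1,\ldots,n$, and $\bar J$ is the normalized matrix of maximum in-forests of the weighted dependency digraph $\Gamma$ of $A$.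
   Context: $\mathbf 1$ is the all-ones column vector of length $n$, $I$ is the identity matrix of order $n$, and $\mathrm{diag}(\boldsymbol{u})$ is the diagonal matrix with the entries of $\boldsymbol{u}$ on the diagonal. ($K$ is the Laplacian matrix of the complete digraph with all arc weights $1/n$.) The weighted dependency digraph $\Gamma$ of $A$ has vertex set $\{1,\ldots,n\}$ and, for every $a_{ij}>0$, an arc $(i,j)$ (from $i$ to $j$) of weight $a_{ij}$. An in-tree (converging tree) with root $r$ is a digraph in which every vertex has a unique directed path to $r$, every vertex other than $r$ has outdegree $1$, and $r$ has outdegree $0$. An in-forest of $\Gamma$ is a spanning subgraph of $\Gamma$ all of whose weakly connected components are in-trees; it is maximum if it has the maximum possible number of arcs among all in-forests of $\Gamma$. The weight of an in-forest is the product of its arc weights (equal to $1$ if there are no arcs). The normalized matrix of maximum in-forests $\bar J=(\bar J_{ij})_{n\times n}$ has as entry $\bar J_{ij}$ the total weight of the maximum in-forests of $\Gamma$ in which $i$ belongs to the tree with root $j$, divided by the total weight of all maximum in-forests of $\Gamma$. (It is known that $\bar J$ coincides with the eigenprojection of $L$ corresponding to the eigenvalue $0$.) *)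

(* Defs.v *)
From mathcomp Require Import all_boot all_order all_algebra.
From mathcomp Require Import all_classical all_reals all_analysis.

Set Implicit Arguments.
Unset Strict Implicit.
Unset Printing Implicit Defensive.

Import Order.TTheory GRing.Theory Num.Theory.
Import numFieldNormedType.Exports.
Local Open Scope ring_scope.

Section Digraphs.
Variable T : finType.

(* A digraph on (a subset of) T is given by its set of arcs; an arc (i, j)
   goes from i to j, and loops are allowed. *)
Implicit Types (F G : {set T * T}) (V : {set T}).

Definition arc_rel F : rel T := fun i j => (i, j) \in F.

Definition outdeg F (i : T) : nat := #|[set a in F | a.1 == i]|.

(* i :: p is the vertex sequence of a path: no vertex is repeated. *)
Definition directed_path F (i : T) (p : seq T) (j : T) : Prop :=
  [/\ path (arc_rel F) i p, uniq (i :: p) & last i p = j].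

Definition weak_component F (i : T) : {set T} :=
  [set j | connect (fun u v => arc_rel F u v || arc_rel F v u) i j].

Definition induced_arcs F V : {set T * T} :=
  [set a in F | (a.1 \in V) && (a.2 \in V)].

Definition in_tree V F (r : T) : Prop :=
  [/\ F \subset finset.setX V V,
      r \in V,
      forall i, i \in V -> exists! p : seq T, directed_path F i p r,
      forall i, i \in V -> i != r -> outdeg F i = 1%N
    & outdeg F r = 0%N].

Definition in_tree_rooted_at F (i r : T) : Prop :=
  in_tree (weak_component F i) (induced_arcs F (weak_component F i)) r.

Definition in_forest G F : Prop :=
  F \subset G /\ forall i, exists r, in_tree_rooted_at F i r.

Definition in_forests G : {set {set T * T}} := [set F | `[< in_forest G F >]].

Definition max_in_forests G : {set {set T * T}} :=
  [set F in in_forests G | [forall H in in_forests G, (#|H| <= #|F|)%N]].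

End Digraphs.

Definition ones (R : realType) (n : nat) : 'cV[R]_n := const_mx 1.

Section WeightedDigraph.
Variables (R : realType) (n : nat) (A : 'M[R]_n).

Definition dependency_digraph : {set 'I_n * 'I_n} := [set a | 0 < A a.1 a.2].

Definition forest_weight (F : {set 'I_n * 'I_n}) : R :=
  \prod_(a in F) A a.1 a.2.

Definition Jbar : 'M[R]_n := \matrix_(i, j)
  ((\sum_(F in max_in_forests dependency_digraph | `[< in_tree_rooted_at F i j >])
      forest_weight F)
   / \sum_(F in max_in_forests dependency_digraph) forest_weight F).

Definition laplacian : 'M[R]_n := diag_mx (A *m ones R n)^T - A.

End WeightedDigraph.

Definition Emx (R : realType) (n : nat) : 'M[R]_n :=
  n%:R^-1 *: (ones R n *m (ones R n)^T).

Definition Kmx (R : realType) (n : nat) : 'M[R]_n := 1%:M - Emx R n.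

Definition colsum (R : realType) (n : nat) (M : 'M[R]_n) (j : 'I_n) : R :=
  \sum_(i < n) M i j.

Local Open Scope classical_set_scope.

(* x' = M x on [0, +oo[, with the one-sided derivative at 0; the values of x
   at negative times are irrelevant. *)
Definition solves_linear_ode (R : realType) (n : nat) (M : 'M[R]_n)
    (x : R -> 'cV[R]_n) : Prop :=
  (forall t : R, 0 < t -> is_derive t 1 x (M *m x t)) /\
  (h^-1 *: (x h - x 0) @[h --> 0^'+] --> M *m x 0).

(* Main.v *)
Require Import Defs.
From mathcomp Require Import all_boot all_order all_algebra.
From mathcomp Require Import ring.
From mathcomp Require Import all_classical all_reals all_analysis.

Set Implicit Arguments.
Unset Strict Implicit.
Unset Printing Implicit Defensive.

Import Order.TTheory GRing.Theory Num.Theory.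
Import numFieldNormedType.Exports.
Local Open Scope ring_scope.
Local Open Scope classical_set_scope.

(** Write M = - (L + delta K), and let u be the row of column sums of
    (I + L / delta)^-1, divided by n.

    Reaching consensus.  Since L 1 = 0, u 1 = 1, whence u M = 0.  So u x(t) is
    constant and the limit must be (u x(0)) 1 as soon as all the differences
    x_i - x_j tend to 0.  In a difference the averaging term E x cancels, so
    d_ij = exp(delta t) (x_i - x_j) evolves by A alone:
    d_ij' = sum_k a_ik (d_kj - d_ij) + sum_k a_jk (d_ik - d_ij).
    As exp is convex, exp(a) (b - a) <= exp(b) - exp(a), which gives
    Phi' <= 2 (sum_ik a_ik) Phi for Phi = sum_ij exp(d_ij).  So Phi grows at most
    exponentially (gronwall), d_ij at most linearly (gap_affine), and
    x_i - x_j = exp(- delta t) d_ij tends to 0 (agreement, consensus).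

    The limit in delta.  A form of the matrix forest theorem (forest_identity)
    says that for arc weights b the total weights Q_ij of the in-forests in
    which the tree of i has root j satisfy
    Q_ij + sum_k b_ik (Q_ij - Q_kj) = [i = j] * (total weight of all in-forests).
    Its proof sorts the in-forests by the arc leaving i: the terms in two
    candidate arcs (i, k) and (i, m) are antisymmetric in k and m and cancel.
    With b = A / delta, this exhibits the entries of (I + L / delta)^-1 as
    quotients of forest polynomials; after multiplication by delta^d, d being the
    size of the maximum in-forests, a forest F contributes
    delta^(d - #|F|) times its weight, so that only the maximum in-forests
    survive at delta = 0 and the limit is Jbar (resolvent_inv, JbarE). *)

(** * Rooted forests as arc sets *)

Section Roots.
Variable T : finType.
Implicit Types (F G : {set T * T}) (i j k m r s : T).

Definition sink F r := [forall y, (r, y) \notin F].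

Definition functional F :=
  [forall x, forall y, forall z, ((x, y) \in F) ==> ((x, z) \in F) ==> (y == z)].

Definition rooted F i r := connect (arc_rel F) i r && sink F r.

(** This boolean form of being an in-forest sees only the outgoing arcs; its
    agreement with the definition by weak components is [in_forestsE] below. *)
Definition forestb F := functional F && [forall i, exists r, rooted F i r].

Lemma sinkP F r : reflect (forall y, (r, y) \notin F) (sink F r).
Proof. exact: forallP. Qed.

Lemma functionalP F :
  reflect (forall x y z, (x, y) \in F -> (x, z) \in F -> y = z) (functional F).
Proof.
apply: (iffP forallP) => [H x y z xy xz|H x].
  move/forallP/(_ y)/forallP/(_ z): (H x).
  by move=> /implyP/(_ xy)/implyP/(_ xz)/eqP.
apply/forallP => y; apply/forallP => z.
by apply/implyP => xy; apply/implyP => xz; apply/eqP/(H x).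
Qed.

Lemma forestP F :
  reflect (functional F /\ forall i, exists r, rooted F i r) (forestb F).
Proof.
apply: (iffP andP) => -[fF H]; split=> //.
  by move=> i; move/forallP/(_ i)/existsP: H.
by apply/forallP => i; apply/existsP.
Qed.

Lemma connect_stepP F i r :
  reflect (i = r \/ exists2 k, (i, k) \in F & connect (arc_rel F) k r)
          (connect (arc_rel F) i r).
Proof.
apply: (iffP idP) => [/connectP[[|k p] /= pth ->]|[->|[k ik kr]]]; first by left.
- case/andP: pth => ik kp; right; exists k => //.
  by apply/connectP; exists p.
- exact: connect0.
- exact: connect_trans (connect1 ik) kr.
Qed.

Lemma connect_sink F r s : sink F r -> connect (arc_rel F) r s = (r == s).
Proof.
move/sinkP => sr; apply/idP/eqP => [/connect_stepP[//|[k]]|->]; last exact: connect0.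
by rewrite (negbTE (sr k)).
Qed.

Lemma sink_rooted F r s : sink F r -> rooted F r s = (r == s).
Proof.
by move=> sr; rewrite /rooted connect_sink//; case: eqP => //= <-.
Qed.

Lemma rooted_step F i k r :
  functional F -> (i, k) \in F -> rooted F i r = rooted F k r.
Proof.
move=> /functionalP fF ik; apply/andP/andP => -[].
  move=> /connect_stepP[<- /sinkP/(_ k)|[l il lr] ->]; first by rewrite ik.
  by rewrite (fF _ _ _ ik il).
by move=> kr ->; split=> //; apply: connect_trans (connect1 ik) kr.
Qed.

Lemma connect_rooted F k s j :
  functional F -> connect (arc_rel F) k s -> rooted F k j = rooted F s j.
Proof.
move=> fF /connectP[p + ->]; elim: p k => //= l p IH k /andP[kl lp].
by rewrite (rooted_step _ fF kl) IH.
Qed.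

Lemma rooted_uniq F i r s :
  functional F -> rooted F i r -> rooted F i s -> r = s.
Proof.
move=> fF /andP[ir sr]; rewrite (connect_rooted _ fF ir) sink_rooted//.
by move/eqP.
Qed.

Lemma rootedE F i r s :
  functional F -> rooted F i r -> rooted F i s = (r == s).
Proof.
by move=> fF ir; apply/idP/eqP => [/(rooted_uniq fF ir)|<-].
Qed.

Section AddArc.
Variables (F : {set T * T}) (i m : T).
Hypotheses (forF : forestb F) (sinki : sink F i) (mi : ~~ rooted F m i).
Let F' := (i, m) |: F.

Lemma functional_add_arc : functional F'.
Proof.
case/forestP: forF => /functionalP fF _; apply/functionalP => x y z.
rewrite !in_setU1 !xpair_eqE.
case: (eqVneq x i) => [->|_] /=; last exact: fF.
by rewrite !(negbTE (sinkP _ _ sinki _)) !orbF => /eqP -> /eqP ->.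
Qed.

Lemma connect_add_arc k s :
  connect (arc_rel F) k s -> connect (arc_rel F') k s.
Proof.
apply: connect_sub => x y xy; apply: connect1.
by rewrite /arc_rel in_setU1 (xy : _ \in F) orbT.
Qed.

Lemma rooted_add_arc_ne k j : ~~ rooted F k i -> rooted F' k j = rooted F k j.
Proof.
case/forestP: (forF) => fF /(_ k)[s ks]; rewrite (rootedE _ fF ks) => si.
rewrite (rootedE _ fF ks).
case/andP: ks => ks ss; rewrite (connect_rooted _ functional_add_arc (connect_add_arc ks)).
rewrite sink_rooted//; apply/sinkP => y.
by rewrite in_setU1 xpair_eqE (negbTE si) /= (sinkP _ _ ss).
Qed.

(** The new arc hangs the whole tree of [i] below [m]: the vertices of that tree
    inherit the root of [m], and all others keep theirs. *)
Lemma rooted_add_arc k j :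
  rooted F' k j = if rooted F k i then rooted F m j else rooted F k j.
Proof.
case: ifP => [/andP[ki _]|/negbT]; last exact: rooted_add_arc_ne.
rewrite (connect_rooted _ functional_add_arc (connect_add_arc ki)).
rewrite (@rooted_step _ _ m) ?functional_add_arc ?finset.setU11//.
exact: rooted_add_arc_ne.
Qed.

Lemma forest_add_arc : forestb F'.
Proof.
apply/forestP; split; first exact: functional_add_arc.
case/forestP: forF => _ rF k; case: (rF k) (rF m) => s ks [r mr].
case: (boolP (rooted F k i)) => ki.
  by exists r; rewrite rooted_add_arc ki.
by exists s; rewrite rooted_add_arc (negbTE ki).
Qed.

End AddArc.

Section RemoveArc.
Variables (F : {set T * T}) (i m : T).
Hypotheses (forF : forestb F) (im : (i, m) \in F).
Let F' := F :\ (i, m).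

Lemma sink_remove_arc : sink F' i.
Proof.
case/forestP: forF => /functionalP fF _; apply/sinkP => y.
rewrite in_setD1; apply/negP => /andP[/eqP ne iy].
by apply: ne; rewrite (fF _ _ _ iy im).
Qed.

Lemma forest_remove_arc : forestb F'.
Proof.
case/forestP: (forF) => /functionalP fF rF; apply/forestP; split.
  by apply/functionalP => x y z; rewrite !in_setD1 => /andP[_ xy] /andP[_]; apply: fF xy.
move=> k; case: (rF k) => r /andP[/connectP[p]].
elim: p k => [k _ /= <- sr|l p IH k /= /andP[kl lp] er sr].
  exists r; rewrite /rooted connect0; apply/sinkP => y.
  by rewrite in_setD1 (negbTE (sinkP _ _ sr y)) andbF.
have [s /andP[ls ss]] := IH _ lp er sr.
case: (eqVneq k i) => [->|ki].
  by exists i; rewrite /rooted connect0 sink_remove_arc.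
exists s; rewrite /rooted ss andbT; apply: connect_trans ls; apply: connect1.
by rewrite /arc_rel in_setD1 xpair_eqE (negbTE ki).
Qed.

(** If [i] were still the root of [m], the arc [(i, m)] would close a cycle
    in [F]: the vertices that lead to [i] in [F'] could then never leave this set
    along [F], so none of them could reach a sink of [F]. *)
Lemma rooted_remove_arc : ~~ rooted F' m i.
Proof.
case/forestP: (forF) => /functionalP fF rF; apply/negP => /andP[mi _].
have sub x y : (x, y) \in F' -> (x, y) \in F by rewrite in_setD1 => /andP[].
have key p x : connect (arc_rel F') x i -> path (arc_rel F) x p ->
    ~~ sink F (last x p).
  elim: p x => [x xi _ /=|y p IH x xi /= /andP[xy yp]].
    apply/negP => /sinkP sx; case/connect_stepP: xi => [ix|[k /sub xk _]].
      by move: (sx m); rewrite ix im.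
    by move: (sx k); rewrite xk.
  apply: (IH y) => //; case/connect_stepP: xi => [xi|[k /sub xk]].
    by rewrite (fF i y m) // -xi.
  by rewrite (fF _ _ _ xy xk).
by case: (rF m) => r /andP[/connectP[p mp ->]]; apply/negP/(key p m mi mp).
Qed.

End RemoveArc.
End Roots.

(** * The matrix forest identity *)

Section ForestIdentity.
Variables (R : comNzRingType) (T : finType) (b : T * T -> R).
Implicit Types (F : {set T * T}) (i j k m : T).

Definition weight F : R := \prod_(a in F) b a.

Definition rooted_total i j : R := \sum_(F | forestb F && rooted F i j) weight F.

Definition forest_total : R := \sum_(F | forestb F) weight F.

(** Forests in which [i] is not a sink correspond, through their arc [(i, m)], to
    forests in which [i] is a sink and [m] is not in the tree of [i]. This turns
    every sum over forests into sums over forests having [i] as a root. *)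
Lemma sum_forests_split i (phi : {set T * T} -> R) :
  \sum_(F | forestb F) weight F * phi F =
  \sum_(F | forestb F && sink F i) weight F * phi F +
  \sum_m b (i, m) *
    \sum_(F | forestb F && sink F i)
      weight F * ((~~ rooted F m i)%:R * phi ((i, m) |: F)).
Proof.
rewrite (bigID (fun F => sink F i)) /=; congr (_ + _).
transitivity (\sum_m \sum_(F | forestb F && ((i, m) \in F)) weight F * phi F).
  rewrite [RHS](exchange_big_dep (fun F => forestb F && ~~ sink F i)) /=; last first.
    move=> m F _ /andP[-> im] /=; apply/negP => /sinkP/(_ m).
    by rewrite im.
  apply: eq_bigr => F /andP[forF nsF].
  case/forestP: (forF) => /functionalP fF _.
  have /existsP[m] : [exists m, (i, m) \in F].
    by apply: contraNT nsF; rewrite negb_exists.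
  move=> im; rewrite (big_pred1 m)// => l /=.
  by rewrite forF /=; apply/idP/eqP => [il|->//]; apply: fF im.
apply: eq_bigr => m _; rewrite mulr_sumr.
rewrite (reindex_onto (fun F => (i, m) |: F) (fun F => F :\ (i, m))) /=; last first.
  by move=> F /andP[_ im]; rewrite finset.setD1K.
rewrite [RHS](bigID (fun F => rooted F m i)) /= [X in _ = X + _]big1 ?add0r; last first.
  by move=> F /andP[_ ->]; rewrite /= mul0r !mulr0.
apply: eq_big => [F|F /andP[/andP[forF imF] /eqP Fe]].
  apply/idP/idP.
    case/andP=> /andP[forF imF] /eqP Fe.
    rewrite -Fe forest_remove_arc// sink_remove_arc//.
    exact: rooted_remove_arc.
  case/andP=> /andP[forF sF] mi.
  rewrite forest_add_arc// finset.setU11 /= finset.setU1K//.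
  exact: (sinkP _ _ sF).
have imnF : (i, m) \notin F by rewrite -Fe finset.setD11.
rewrite /weight big_setU1//= mulrA mulrA; congr (_ * _).
rewrite (_ : rooted F m i = false) ?mulr1//.
by apply/negbTE; rewrite -Fe rooted_remove_arc.
Qed.

Lemma rooted_totalE i j :
  rooted_total i j = \sum_(F | forestb F) weight F * (rooted F i j)%:R.
Proof.
rewrite /rooted_total big_mkcondr; apply: eq_bigr => F _.
by case: ifP; rewrite ?mulr1 ?mulr0.
Qed.

(** A form of the matrix forest theorem: the identity plus the Laplacian of [b],
    times the matrix of the [rooted_total i j], is [forest_total] times the identity.
    After [sum_forests_split], all sums range over the forests with root [i]. The
    contributions quadratic in the arcs leaving [i] are
    [b (i, k) * b (i, m) * (Y k m - Y m k)] and cancel in pairs; those linear in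
    these arcs reassemble, when [j = i], into the splitting of [forest_total]. *)
Lemma forest_identity i j :
  rooted_total i j
    + \sum_k b (i, k) * (rooted_total i j - rooted_total k j)
  = (i == j)%:R * forest_total.
Proof.
pose S phi := \sum_(F | forestb F && sink F i) weight F * phi F : R.
pose p F k : R := (rooted F k i)%:R.
pose rho F k : R := (rooted F k j)%:R.
have SD f g : S (fun F => f F + g F) = S f + S g.
  by rewrite -big_split; apply: eq_bigr => F _; rewrite mulrDr.
have SN f : S (fun F => - f F) = - S f.
  by rewrite -sumrN; apply: eq_bigr => F _; rewrite mulrN.
have eqS f g : (forall F, forestb F -> sink F i -> f F = g F) -> S f = S g.
  by move=> fg; apply: eq_bigr => F /andP[fF sF]; rewrite fg.
have Qk k : rooted_total k j = S (rho ^~ k) + \sum_m b (i, m) *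
    S (fun F => (1 - p F m) * (p F k * rho F m + (1 - p F k) * rho F k)).
  rewrite rooted_totalE (sum_forests_split i); congr (_ + _).
  apply: eq_bigr => m _; congr (_ * _); apply: eqS => F forF sF.
  rewrite /p /rho; case: (boolP (rooted F m i)) => mi; rewrite /= ?subrr ?mul0r//.
  rewrite rooted_add_arc// subr0 !mul1r.
  by case: ifP; rewrite /= ?subrr ?subr0 !(mul1r, mul0r) ?addr0 ?add0r.
have Qi : rooted_total i j = S (fun=> (i == j)%:R)
    + \sum_m b (i, m) * S (fun F => (1 - p F m) * rho F m).
  rewrite Qk; congr (_ + _).
    by apply: eqS => F _ sF; rewrite /rho sink_rooted.
  apply: eq_bigr => m _; congr (_ * _); apply: eqS => F _ sF.
  by rewrite /p [rooted F i i]sink_rooted// eqxx subrr mul0r addr0 mul1r.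
pose Y k m := S (fun F => (1 - p F m) * (1 - p F k) * rho F m).
have QiQk k : rooted_total i j - rooted_total k j =
    S (fun F => (i == j)%:R - rho F k) + \sum_m b (i, m) * (Y k m - Y m k).
  rewrite Qi Qk opprD addrACA -SN -SD; congr (_ + _).
  rewrite -sumrB; apply: eq_bigr => m _; rewrite -mulrBr; congr (_ * _).
  rewrite /Y -!SN -!SD; apply: eqS => F _ _; ring.
have antisym : \sum_k b (i, k) * (\sum_m b (i, m) * (Y k m - Y m k)) = 0.
  under eq_bigr do rewrite mulr_sumr.
  under eq_bigr => k _ do under eq_bigr => m _ do rewrite !mulrBr.
  under eq_bigr do rewrite sumrB.
  rewrite sumrB [X in _ - X]exchange_big /= -sumrB big1// => k _.
  by rewrite -sumrB big1// => m _; rewrite mulrCA subrr.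
under eq_bigr do rewrite QiQk mulrDr.
rewrite big_split /= antisym addr0 Qi -addrA -big_split /=.
have -> : forest_total = S (fun=> 1) + \sum_m b (i, m) * S (fun F => 1 - p F m).
  transitivity (\sum_(F | forestb F) weight F * 1).
    by apply: eq_bigr => F _; rewrite mulr1.
  rewrite (sum_forests_split i); congr (_ + _).
  apply: eq_bigr => m _; congr (_ * _); apply: eqS => F _ _.
  by rewrite /p mulr1; case: rooted; rewrite /= ?subrr ?subr0.
have scale c f : c * S f = S (fun F => c * f F).
  by rewrite mulr_sumr; apply: eq_bigr => F _; rewrite mulrCA.
rewrite mulrDr scale mulr_sumr; congr (_ + _); first by apply: eqS => F _ _; rewrite mulr1.
apply: eq_bigr => k _; rewrite mulrCA -mulrDr; congr (_ * _).
rewrite scale -SD; apply: eqS => F /forestP[fF _] sF.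
(* A forest counted by both factors roots [k] at [i] and at [j], so [i = j]. *)
have prho : p F k * rho F k = (i == j)%:R * p F k.
  rewrite /p /rho; case: (boolP (rooted F k i)) => ki; last by rewrite mul0r mulr0.
  by rewrite (rootedE _ fF ki) mul1r mulr1.
by rewrite mulrBr mulr1 -prho; ring.
Qed.

End ForestIdentity.

(** * Converging trees and maximum in-forests *)

Section InForests.
Variable T : finType.
Implicit Types (F G : {set T * T}) (i j k r : T).

Lemma sink_outdeg F r : (outdeg F r == 0%N) = sink F r.
Proof.
rewrite cards_eq0; apply/eqP/sinkP => [F0 y|sF].
  apply/negP => ry; have := finset.in_set0 (r, y); rewrite -F0 inE ry /=.
  by rewrite eqxx.
apply/finset.setP => -[x y]; rewrite !inE /=; apply/negP => /andP[xy /eqP xr].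
by move: (sF y); rewrite -xr xy.
Qed.

Lemma functional_outdeg F : functional F <-> forall i, (outdeg F i <= 1)%N.
Proof.
split=> [/functionalP fF i|H].
  apply/card_le1_eqP => -[x y] [x' y']; rewrite !inE /=.
  by move=> /andP[xy /eqP xi] /andP[xy' /eqP xi']; subst; rewrite (fF _ _ _ xy xy').
apply/functionalP => x y z xy xz.
have /card_le1_eqP/(_ (x, y) (x, z)) := H x.
by rewrite !inE xy xz /= eqxx => /(_ isT isT) [].
Qed.

Lemma in_weak_component F i : i \in weak_component F i.
Proof. by rewrite inE connect0. Qed.

Lemma weak_component_arc F i k l :
  (k, l) \in F -> k \in weak_component F i -> l \in weak_component F i.
Proof.
rewrite !inE => kl ik; apply: connect_trans ik (connect1 _).
by rewrite /arc_rel kl.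
Qed.

Lemma induced_arc F i k l : k \in weak_component F i ->
  ((k, l) \in induced_arcs F (weak_component F i)) = ((k, l) \in F).
Proof.
move=> kV; rewrite inE /= kV /=; apply/andP/idP => [[]//|kl].
by split=> //; apply: weak_component_arc kl kV.
Qed.

Lemma outdeg_induced F i k : k \in weak_component F i ->
  outdeg (induced_arcs F (weak_component F i)) k = outdeg F k.
Proof.
move=> kV; congr (#|pred_of_set _|); apply/finset.setP => -[x y].
rewrite 2!finset.in_set /=; case: (eqVneq x k) => [->|]; rewrite ?andbF// !andbT.
exact: induced_arc.
Qed.

Lemma path_induced F i k p : k \in weak_component F i ->
  path (arc_rel (induced_arcs F (weak_component F i))) k p = path (arc_rel F) k p.
Proof.
elim: p k => //= l p IH k kV; rewrite {1}/arc_rel induced_arc//.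
case: (boolP ((k, l) \in F)) => kl; rewrite /arc_rel ?kl ?(negbTE kl)//=.
by rewrite IH//; apply: weak_component_arc kl kV.
Qed.

(** Weak components are closed under outgoing arcs, so paths and outdegrees
    within a component are those of the whole digraph. *)
Lemma tree_rooted F i r : in_tree_rooted_at F i r -> rooted F i r.
Proof.
case=> _ rV paths _ out_r; have iV := in_weak_component F i.
have [p [[+ _ lp] _]] := paths _ iV; rewrite path_induced// => pth.
rewrite /rooted -sink_outdeg -out_r outdeg_induced// eqxx andbT.
by apply/connectP; exists p.
Qed.

(** With at most one arc out of each vertex a walk is determined by its start and
    its length, and a sink stops it; this gives the uniqueness of the path to the
    root required of a converging tree. *)
Lemma path_to_sink_uniq F k p q r : functional F -> sink F r ->
  path (arc_rel F) k p -> last k p = r ->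
  path (arc_rel F) k q -> last k q = r -> p = q.
Proof.
move=> /functionalP fF /sinkP sr; have nosucc l : (r, l) \in F -> False.
  by move=> rl; move: (sr l); rewrite rl.
elim: p k q => [|x p IH] k [|y q]//=.
- by move=> _ kr /andP[ky _] _; case: (nosucc y); rewrite -kr.
- by move=> /andP[kx _] _ _ kr; case: (nosucc x); rewrite -kr.
- move=> /andP[kx xp] lp /andP[ky yq] lq; move: (fF _ _ _ kx ky) => exy.
  by subst y; rewrite (IH x q).
Qed.

(** Both ends of an arc have the same root, hence so do all the vertices that are
    connected when the directions of arcs are ignored. *)
Lemma weak_component_rooted F i k r : functional F -> k \in weak_component F i ->
  rooted F k r = rooted F i r.
Proof.
move=> fF; rewrite inE => /connectP[p + ->]; elim: p i => //= l p IH i.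
move=> /andP[il lp]; rewrite IH//.
by case/orP: il => il; rewrite (rooted_step _ fF il).
Qed.

Lemma rooted_tree F i r : functional F -> rooted F i r -> in_tree_rooted_at F i r.
Proof.
move=> fF ir; have sr : sink F r by case/andP: ir.
have rV : r \in weak_component F i.
  case/andP: ir => ir _; rewrite inE; apply: connect_sub ir => x y xy.
  by apply: connect1; rewrite xy.
split=> //.
- by apply/fintype.subsetP => -[x y]; rewrite !inE => /andP[_].
- move=> k kV; have : rooted F k r by rewrite (weak_component_rooted _ fF kV).
  case/andP=> /connectP[p pth er] _.
  case: (shortenP pth) er => q qth uq _ er; exists q; split.
    by split; rewrite ?path_induced.
  move=> q' [q'th _ lq']; rewrite path_induced// in q'th.
  exact: (path_to_sink_uniq fF sr qth (esym er) q'th lq').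
- move=> k kV kr; rewrite outdeg_induced//; apply/eqP.
  rewrite eqn_leq (functional_outdeg F).1//= lt0n sink_outdeg.
  apply: contra kr => sk; move: (weak_component_rooted r fF kV).
  by rewrite ir sink_rooted.
- by rewrite outdeg_induced//; apply/eqP; rewrite sink_outdeg.
Qed.

Lemma in_tree_rootedE F i r : functional F -> `[< in_tree_rooted_at F i r >] = rooted F i r.
Proof.
by move=> fF; apply/asboolP/idP; [exact: tree_rooted|exact: rooted_tree].
Qed.

Lemma in_forestsE G F : (F \in in_forests G) = (F \subset G) && forestb F.
Proof.
rewrite inE; apply/asboolP/andP => [[FG trees]|[FG /forestP[fF rF]]]; split=> //.
  apply/forestP; split; last by move=> i; case: (trees i) => r /tree_rooted; exists r.
  apply/functional_outdeg => i; case: (trees i) => r [_ _ _ out1 out0].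
  have iV := in_weak_component F i.
  case: (eqVneq i r) => [ir|ne]; last by rewrite -(outdeg_induced iV) out1.
  by rewrite -(outdeg_induced iV) {2}ir out0.
by move=> i; case: (rF i) => r ir; exists r; apply: rooted_tree.
Qed.

Lemma in_forests0 G : finset.set0 \in in_forests G.
Proof.
rewrite in_forestsE finset.sub0set; apply/forestP; split.
  by apply/functionalP => x y z; rewrite inE.
by move=> i; exists i; rewrite /rooted connect0; apply/sinkP => y; rewrite inE.
Qed.

Definition forest_dim G := \max_(F in in_forests G) #|F|.

Lemma forest_dim_ge G F : F \in in_forests G -> (#|F| <= forest_dim G)%N.
Proof. exact: (@leq_bigmax_cond _ (mem (in_forests G)) (fun F => #|F|)). Qed.

Lemma forest_dim_attained G : exists2 F, F \in in_forests G & #|F| = forest_dim G.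
Proof.
have [|F FG e] := @eq_bigmax_cond _ (mem (in_forests G)) (fun F => #|F|).
  by apply/card_gt0P; exists finset.set0; exact: in_forests0.
by exists F.
Qed.

Lemma max_in_forestsE G F :
  (F \in max_in_forests G) = (F \in in_forests G) && (#|F| == forest_dim G).
Proof.
rewrite inE; apply: andb_id2l => FG; apply/forall_inP/eqP => [mx|-> H]; last exact: forest_dim_ge.
apply/eqP; rewrite eqn_leq forest_dim_ge//.
by case: (forest_dim_attained G) => H HG <-; apply: mx.
Qed.

End InForests.

(** * The resolvent of the Laplacian and its limit *)

Section ForestResolvent.
Variables (R : realType) (n : nat) (A : 'M[R]_n).
Hypothesis A_ge0 : forall i j, 0 <= A i j.
Implicit Types F : {set 'I_n * 'I_n}.
Let G := dependency_digraph A.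
Let d := forest_dim G.

Lemma laplacian_mulE p (M : 'M[R]_(n, p)) i j :
  (laplacian A *m M) i j = \sum_k A i k * (M i j - M k j).
Proof.
rewrite mulmxBl mul_diag_mx !mxE mulr_suml -sumrB.
by apply: eq_bigr => k _; rewrite mxE mulr1 mulrBr.
Qed.

(** The total weight of the forests in [P] for arc weights [A / delta] is a
    polynomial in [1 / delta]; this is the reversed polynomial, obtained on
    multiplying by [delta ^+ d]. Its value at 0 involves the maximum forests only. *)
Definition forest_poly (P : pred {set 'I_n * 'I_n}) : {poly R} :=
  \sum_(F : {set 'I_n * 'I_n} | (F \in in_forests G) && P F) forest_weight A F *: 'X^(d - #|F|).

Definition rooted_poly i j := forest_poly (fun F => rooted F i j).

Definition total_poly := forest_poly predT.

Lemma forest_weight_ge0 F : 0 <= forest_weight A F.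
Proof. by apply: prodr_ge0 => a _. Qed.

Lemma forest_weight_gt0 F : F \subset G -> 0 < forest_weight A F.
Proof.
move=> /fintype.subsetP FG; apply: prodr_gt0 => a /FG.
by rewrite inE.
Qed.

Lemma forest_weight_eq0 F : ~~ (F \subset G) -> forest_weight A F = 0.
Proof.
case/subsetPn => a aF; rewrite inE lt_neqAle A_ge0 andbT negbK => /eqP a0.
by rewrite /forest_weight (bigD1 a)//= -a0 mul0r.
Qed.

Lemma weight_scale (c : R) F :
  weight (fun a => c * A a.1 a.2) F = c ^+ #|F| * forest_weight A F.
Proof. by rewrite /weight big_split /= prodr_const. Qed.

(** Forests using an arc outside the dependency digraph have weight 0, so the sum
    may range over all forests on the vertex set. *)
Lemma sum_forests_inv (delta : R) (P : pred {set 'I_n * 'I_n}) : delta != 0 ->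
  delta ^+ d * \sum_(F | forestb F && P F)
      weight (fun a => delta^-1 * A a.1 a.2) F =
  (forest_poly P).[delta].
Proof.
move=> d0; rewrite horner_sum mulr_sumr.
rewrite (bigID (fun F => F \subset G)) /= [X in _ + X]big1 ?addr0; last first.
  by move=> F /andP[_ FG]; rewrite weight_scale forest_weight_eq0// !mulr0.
apply: eq_big => [F|F /andP[/andP[fF _] FG]].
  by rewrite in_forestsE andbC andbA.
rewrite weight_scale hornerZ hornerXn mulrA mulrC; congr (_ * _).
have le : (#|F| <= d)%N by apply: forest_dim_ge; rewrite in_forestsE FG.
by rewrite -{1}(subnK le) exprD exprVn mulfK// expf_neq0.
Qed.

(** Positivity includes [delta = 0], thanks to a forest of maximum size; this is
    what makes the limit of the resolvent finite. *)
Lemma total_poly_gt0 (delta : R) : 0 <= delta -> 0 < total_poly.[delta].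
Proof.
move=> d0; rewrite horner_sum.
have [F FG cF] := forest_dim_attained G.
rewrite (bigD1 F)/=; last by rewrite FG.
apply: ltr_wpDr.
  apply: sumr_ge0 => H _; rewrite hornerZ hornerXn mulr_ge0 ?exprn_ge0//.
  exact: forest_weight_ge0.
rewrite hornerZ hornerXn cF subnn expr0 mulr1; apply: forest_weight_gt0.
by move: FG; rewrite in_forestsE => /andP[].
Qed.

Lemma resolvent_mul_rooted (delta : R) : delta != 0 ->
  (1%:M + delta^-1 *: laplacian A) *m (\matrix_(i, j) (rooted_poly i j).[delta])
  = (total_poly.[delta])%:M.
Proof.
move=> d0; pose b (a : 'I_n * 'I_n) := delta^-1 * A a.1 a.2.
have rE i j : (rooted_poly i j).[delta] = delta ^+ d * rooted_total b i j.
  by rewrite -sum_forests_inv.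
have tE : total_poly.[delta] = delta ^+ d * forest_total b.
  rewrite -sum_forests_inv//; congr (_ * _).
  by apply: eq_bigl => F; rewrite andbT.
apply/matrixP => i j; rewrite mulmxDl mul1mx -scalemxAl [LHS]mxE [X in _ + X]mxE.
rewrite laplacian_mulE [X in X + _]mxE [RHS]mxE tE rE -mulr_natl mulrCA.
rewrite -forest_identity mulrDr; congr (_ + _).
rewrite !mulr_sumr; apply: eq_bigr => k _.
rewrite !mxE (rE i j) (rE k j) [b _]/b /= -mulrBr !mulrA; congr (_ * _).
by rewrite -[RHS]mulrA mulrC.
Qed.

Lemma resolvent_unit (delta : R) : 0 < delta ->
  1%:M + delta^-1 *: laplacian A \in unitmx.
Proof.
move=> d0; have t0 := total_poly_gt0 (ltW d0).
have := resolvent_mul_rooted (lt0r_neq0 d0).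
move/(congr1 (fun M => M *m (total_poly.[delta])^-1%:M)).
by rewrite -scalar_mxM mulfV ?lt0r_neq0// -mulmxA => /mulmx1_unit[].
Qed.

Lemma resolvent_inv (delta : R) i j : 0 < delta ->
  invmx (1%:M + delta^-1 *: laplacian A) i j =
  (rooted_poly i j).[delta] / total_poly.[delta].
Proof.
move=> d0; have t0 := total_poly_gt0 (ltW d0).
have /(congr1 (mulmx (invmx (1%:M + delta^-1 *: laplacian A)))) :=
  resolvent_mul_rooted (lt0r_neq0 d0).
rewrite mulKmx ?resolvent_unit// mul_mx_scalar => /matrixP/(_ i j).
by rewrite !mxE => ->; rewrite mulrC mulKf// lt0r_neq0.
Qed.

Lemma horner0_max (P : pred {set 'I_n * 'I_n}) :
  (forest_poly P).[0] =
  \sum_(F : {set 'I_n * 'I_n} | (F \in max_in_forests G) && P F) forest_weight A F.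
Proof.
rewrite horner_sum (bigID (fun F => #|F| == d)) /= [X in _ + X]big1 ?addr0.
  apply: eq_big => [F|F /andP[_ /eqP ->]].
    by rewrite max_in_forestsE andbAC.
  by rewrite hornerZ hornerXn subnn mulr1.
move=> F /andP[/andP[FG _] ne]; rewrite hornerZ hornerXn expr0n subn_eq0.
by rewrite leqNgt ltn_neqAle ne forest_dim_ge// mulr0.
Qed.

Lemma JbarE i j : Jbar A i j = (rooted_poly i j).[0] / total_poly.[0].
Proof.
rewrite mxE !horner0_max; congr (_ / _).
  apply: eq_bigl => F; apply: andb_id2l.
  rewrite max_in_forestsE in_forestsE => /andP[/andP[_ /forestP[fF _]] _].
  exact: in_tree_rootedE.
by apply: eq_bigl => F; rewrite andbT.
Qed.

Lemma resolvent_cvg i j :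
  invmx (1%:M + delta^-1 *: laplacian A) i j @[delta --> 0^'+] --> Jbar A i j.
Proof.
have cvgE : (rooted_poly i j).[x] / total_poly.[x] @[x --> (0:R)^'+] -->
    (rooted_poly i j).[0] / total_poly.[0].
  apply: cvg_at_right_filter; apply: cvgM; first exact: continuous_horner.
  by apply: cvgV; [rewrite lt0r_neq0// total_poly_gt0|exact: continuous_horner].
rewrite JbarE; apply: cvg_trans cvgE; apply: near_eq_cvg.
near=> x; apply/esym; apply: resolvent_inv.
by near: x; exact: nbhs_right_gt.
Unshelve. all: by end_near. Qed.

End ForestResolvent.

(** * Growth and decay on the half line *)

Section RealAnalysis.
Variable R : realType.
Implicit Types (f df : R -> R) (s t : R).

Lemma is_derive_sumfun n (h : 'I_n -> R -> R) (t : R) (dh : 'I_n -> R) :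
  (forall i, is_derive t 1 (h i) (dh i)) ->
  is_derive t 1 (fun s => \sum_i h i s) (\sum_i dh i).
Proof.
move=> hd; rewrite (_ : (fun s => _) = \sum_(i < n) h i); first exact: is_derive_sum.
by apply/funext => s; rewrite fct_sumE.
Qed.

Lemma is_derive_coord m n (x : R -> 'M[R]_(m, n)) (t : R) v i j :
  is_derive t 1 x v -> is_derive t 1 (fun s => x s i j) (v i j).
Proof.
move=> dx; have [xd _] := dx.
split; first by apply: (derivable_mxP x t 1).1.
by rewrite -[in RHS](@derive_val _ _ _ _ _ _ _ dx) derive_mx// mxE.
Qed.

Lemma cvg_mx_coord (U : Type) (F : set_system U) (FF : Filter F) m n
    (f : U -> 'M[R]_(m, n)) (l : 'M[R]_(m, n)) :
  (forall i j, f u i j @[u --> F] --> l i j) -> f u @[u --> F] --> l.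
Proof.
move=> fl; apply/cvgrPdist_le => e e0; near=> u.
rewrite /Num.Def.normr/= mx_normrE (bigmax_le _ (ltW e0))//= => i _.
rewrite !mxE; move: i; near: u; apply: filter_forall => -[i j] /=.
by move/cvgrPdist_le: (fl i j); exact.
Unshelve. all: by end_near. Qed.

Lemma derive_le0_homo f df :
  (forall t, 0 < t -> is_derive t 1 f (df t)) ->
  (forall t, 0 < t -> df t <= 0) ->
  forall s t, 0 < s -> s <= t -> f t <= f s.
Proof.
move=> fd df0 s t s0 st.
have pos u : u \in `[s, t]%R -> 0 < u.
  by rewrite in_itv /= => /andP[+ _]; exact: lt_le_trans.
have posoo u : u \in `]s, t[%R -> 0 < u.
  by rewrite in_itv /= => /andP[+ _]; exact: lt_trans.
apply: (@ler0_derive1_le_cc _ f s t) => //.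
- by move=> u /posoo/fd[].
- by move=> u /posoo u0; rewrite derive1E (@derive_val _ _ _ _ _ _ _ (fd _ u0)) df0.
- by apply: derivable_within_continuous => u /pos/fd[].
- by rewrite in_itv /= ?lexx st.
- by rewrite in_itv /= ?lexx st.
Qed.

Lemma derive_0_const f : (forall t, 0 < t -> is_derive t 1 f 0) ->
  f t @[t --> 0^'+] --> f 0 -> forall t, 0 < t -> f t = f 0.
Proof.
move=> fd f0.
have Nfd t : 0 < t -> is_derive t 1 (- f) 0.
  by move=> /fd ?; rewrite -oppr0; exact: is_deriveN.
have const s t : 0 < s -> s <= t -> f s = f t.
  move=> s0 st; apply/eqP; rewrite eq_le -lerN2.
  rewrite (derive_le0_homo fd _ s0 st) ?andbT//.
  exact: (derive_le0_homo Nfd _ s0 st).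
move=> t t0; apply: (cvg_unique _ _ f0); first exact: norm_hausdorff.
apply: cvg_near_cst; near=> s; apply: const => //.
by near: s; exact: nbhs_right_le.
Unshelve. all: by end_near. Qed.

Lemma is_derive_expRM (c s d : R) f : is_derive s 1 f d ->
  is_derive s 1 (fun u => expR (c * u) * f u) (expR (c * s) * (d + c * f s)).
Proof.
move=> fs; have e : is_derive s 1 (expR \o (c \*: id)) (expR (c * s) * (c *: 1)).
  exact: is_derive1_comp.
apply: (@is_derive_eq _ _ _ ((expR \o (c \*: id)) * f)).
by rewrite /= /GRing.scale /=; ring.
Qed.

(** The base point 1, inside the open half line, avoids any continuity
    requirement at 0. *)
Lemma gronwall (c : R) f df :
  (forall t, 0 < t -> is_derive t 1 f (df t)) ->
  (forall t, 0 < t -> df t <= c * f t) ->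
  forall t, 1 <= t -> f t <= f 1 * expR (c * (t - 1)).
Proof.
move=> fd fle t t1.
have gd s : 0 < s -> is_derive s 1 (fun u => expR (- c * u) * f u)
    (expR (- c * s) * (df s - c * f s)).
  by move=> /fd fs; rewrite -mulNr; exact: is_derive_expRM.
have gle0 s : 0 < s -> expR (- c * s) * (df s - c * f s) <= 0.
  by move=> s0; rewrite mulr_ge0_le0 ?expR_ge0// subr_le0 fle.
have := derive_le0_homo gd gle0 ltr01 t1; rewrite mulr1 !mulNr -(ler_pM2l (expR_gt0 (c * t))).
rewrite mulrA -expRD subrr expR0 mul1r mulrA -expRD => /le_trans; apply.
by rewrite mulrC mulrBr mulr1.
Qed.

Lemma expR_tangent (a b : R) : expR a * (b - a) <= expR b - expR a.
Proof.
have := expR_ge1Dx (b - a); rewrite -(ler_pM2l (expR_gt0 a)) -expRD subrKC.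
by rewrite mulrDr mulr1 lerBrDl.
Qed.

(** Half of the exponential factor absorbs the affine bound, since
    [expR (delta / 2 * t)] dominates both [delta / 2 * t] and 1. *)
Lemma affine_decay (delta a c : R) f : 0 < delta -> 0 <= a -> 0 <= c ->
  (forall t, 1 <= t -> `|expR (delta * t) * f t| <= a * t + c) ->
  f t @[t --> +oo] --> 0.
Proof.
move=> d0 a0 c0 H; apply: norm_cvg0.
pose B := a * (delta / 2)^-1 + c.
apply: (@squeeze_cvgr _ _ _ _ (cst 0) (fun t => B * expR (- (delta / 2 * t)))).
- near=> t; rewrite normr_ge0 /=.
  have t1 : 1 <= t by near: t; exact: nbhs_pinfty_ge.
  have t0 : 0 <= t by apply: le_trans t1.
  have := H t t1; rewrite normrM (ger0_norm (expR_ge0 _)) => {}H.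
  have le1 : 1 <= expR (delta / 2 * t).
    by rewrite -expR0 ler_expR mulr_ge0// divr_ge0// ltW.
  have leE : delta / 2 * t <= expR (delta / 2 * t).
    by apply: le_trans (expR_ge1Dx _); rewrite lerDr.
  rewrite expRN ler_pdivlMr ?expR_gt0// -(ler_pM2r (expR_gt0 (delta / 2 * t))).
  rewrite -[leLHS]mulrA -expRD -mulrDl -splitr mulrC (le_trans H)// /B mulrDl lerD//.
    rewrite -[leRHS]mulrA ler_wpM2l // mulrC ler_pdivlMr ?divr_gt0//.
    by rewrite mulrC.
  by rewrite ler_peMr.
- exact: cvg_cst.
- rewrite -[0](mulr0 B); apply: cvgMl_tmp.
  apply: (@cvg_comp _ _ _ (fun t => delta / 2 * t) (fun y => expR (- y))).
    by apply: gt0_cvgMry => //; rewrite divr_gt0.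
  exact: cvgr_expR.
Unshelve. all: by end_near. Qed.

End RealAnalysis.

(** * Consensus under the regularized dynamics *)

Section Consensus.
Variables (R : realType) (n : nat) (A : 'M[R]_n) (delta : R).
Hypotheses (n_gt0 : (0 < n)%N) (A_ge0 : forall i j, 0 <= A i j).
Hypothesis delta_gt0 : 0 < delta.
Local Notation generator := (- (laplacian A + delta *: Kmx R n)).

Lemma EmxE p (M : 'M[R]_(n, p)) i j :
  (Emx R n *m M) i j = n%:R^-1 * \sum_k M k j.
Proof.
rewrite -scalemxAl mxE -mulmxA mxE big_ord1 !mxE mul1r; congr (_ * _).
by apply: eq_bigr => k _; rewrite !mxE mul1r.
Qed.

Lemma KmxE p (M : 'M[R]_(n, p)) i j :
  (Kmx R n *m M) i j = M i j - n%:R^-1 * \sum_k M k j.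
Proof. by rewrite mulmxBl mul1mx mxE [X in _ + X]mxE EmxE. Qed.

Lemma generatorE (v : 'cV[R]_n) i :
  (generator *m v) i 0 = \sum_k A i k * (v k 0 - v i 0)
     + delta * (n%:R^-1 * \sum_k v k 0 - v i 0).
Proof.
rewrite mulNmx mulmxDl -scalemxAl mxE [X in - X]mxE laplacian_mulE.
rewrite [X in _ + X]mxE KmxE.
rewrite opprD -mulrN opprB; congr (_ + _); rewrite -sumrN.
by apply: eq_bigr => k _; rewrite -mulrN opprB.
Qed.

Section Solution.
Variable x : R -> 'cV[R]_n.
Hypothesis dx : forall t : R, 0 < t -> is_derive t 1 x (generator *m x t).

(** The factor [expR (delta * t)] compensates exactly for the damping that
    [delta *: K] imposes on differences of coordinates. *)
Let gap (i j : 'I_n) (t : R) := expR (delta * t) * (x t i 0 - x t j 0).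

(** The mean of the coordinates, which enters through [K], drops out of
    differences; what remains pulls [gap i j] towards gaps that share one of its
    two indices. *)
Lemma is_derive_gap i j (t : R) : 0 < t -> is_derive t 1 (gap i j)
  (\sum_k A i k * (gap k j t - gap i j t) + \sum_k A j k * (gap i k t - gap i j t)).
Proof.
move=> t0; have dxi k := is_derive_coord k 0 (dx t0).
have dxij := is_deriveB (dxi i) (dxi j).
apply: (is_derive_eq (is_derive_expRM delta dxij)).
rewrite [X in _ + delta * X](_ : _ = x t i 0 - x t j 0)//.
rewrite !generatorE.
set si := \sum_k A i k * (x t k 0 - x t i 0).
set sj := \sum_k A j k * (x t k 0 - x t j 0).
have -> : \sum_k A i k * (gap k j t - gap i j t) = expR (delta * t) * si.
  by rewrite mulr_sumr; apply: eq_bigr => k _; rewrite /gap; ring.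
have -> : \sum_k A j k * (gap i k t - gap i j t) = - (expR (delta * t) * sj).
  by rewrite mulr_sumr -sumrN; apply: eq_bigr => k _; rewrite /gap; ring.
ring.
Qed.

Let Phi (t : R) := \sum_i \sum_j expR (gap i j t).
Let weightA := \sum_i \sum_k A i k.

Lemma weightA_ge0 : 0 <= weightA.
Proof. by apply: sumr_ge0 => i _; apply: sumr_ge0. Qed.

Lemma gap_le_Phi i j t : expR (gap i j t) <= Phi t.
Proof.
rewrite /Phi (bigD1 i)//= (bigD1 j)//= -addrA lerDl addr_ge0//.
  by apply: sumr_ge0 => l _; exact: expR_ge0.
by apply: sumr_ge0 => k _; apply: sumr_ge0 => l _; exact: expR_ge0.
Qed.

(** By convexity each product [expR (gap i j) * (gap k l - gap i j)] is at most
    [expR (gap k l)]; summed with the weights [A], these are bounded by [Phi]. *)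
Lemma Phi_growth (t : R) :
  \sum_i \sum_j expR (gap i j t) *
    (\sum_k A i k * (gap k j t - gap i j t) + \sum_k A j k * (gap i k t - gap i j t))
  <= (2 * weightA) * Phi t.
Proof.
have tangent i j k l : expR (gap i j t) * (gap k l t - gap i j t) <= expR (gap k l t).
  by apply: le_trans (expR_tangent _ _) _; rewrite gerBl expR_ge0.
have row i : \sum_j expR (gap i j t) <= Phi t.
  rewrite /Phi [leRHS](bigD1 i)//= lerDl.
  by apply: sumr_ge0 => k _; apply: sumr_ge0 => l _; exact: expR_ge0.
have col j : \sum_i expR (gap i j t) <= Phi t.
  rewrite /Phi exchange_big [leRHS](bigD1 j)//= lerDl.
  by apply: sumr_ge0 => k _; apply: sumr_ge0 => l _; exact: expR_ge0.
under eq_bigr do under eq_bigr do rewrite mulrDr.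
under eq_bigr do rewrite big_split /=.
rewrite big_split /= [2 * weightA]mulrDl !mul1r mulrDl lerD//.
  rewrite /weightA mulr_suml; apply: ler_sum => i _.
  under eq_bigr do rewrite mulr_sumr.
  rewrite exchange_big mulr_suml /=; apply: ler_sum => k _.
  apply: le_trans (_ : \sum_j A i k * expR (gap k j t) <= _).
    by apply: ler_sum => j _; rewrite mulrCA ler_wpM2l.
  by rewrite -mulr_sumr ler_wpM2l.
rewrite exchange_big /weightA mulr_suml; apply: ler_sum => j _ /=.
under eq_bigr do rewrite mulr_sumr.
rewrite exchange_big mulr_suml /=; apply: ler_sum => k _.
apply: le_trans (_ : \sum_i A j k * expR (gap i k t) <= _).
  by apply: ler_sum => i _; rewrite mulrCA ler_wpM2l.
by rewrite -mulr_sumr ler_wpM2l.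
Qed.

(** Every single gap is at most the logarithm of [Phi], which grows at most
    linearly; the lower bound follows by exchanging the indices. *)
Lemma gap_affine : exists2 c, 0 <= c &
  forall i j t, 1 <= t -> `|gap i j t| <= 2 * weightA * t + c.
Proof.
have PhiG := @gronwall _ (2 * weightA) Phi _ _ (fun t _ => Phi_growth t).
have {}PhiG t : 1 <= t -> Phi t <= Phi 1 * expR (2 * weightA * (t - 1)).
  apply: PhiG => s s0; apply: is_derive_sumfun => i; apply: is_derive_sumfun => j.
  have dg := is_derive_gap i j s0.
  exact: (@is_derive1_comp _ expR (gap i j)).
exists `|ln (Phi 1)| => // i j t t1.
have upper k l : gap k l t <= 2 * weightA * t + `|ln (Phi 1)|.
  have Phi1 : 0 < Phi 1 by apply: lt_le_trans (gap_le_Phi k l 1); exact: expR_gt0.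
  have := le_trans (gap_le_Phi k l t) (PhiG t t1).
  rewrite -{1}(lnK Phi1) -expRD ler_expR addrC => /le_trans; apply.
  rewrite lerD ?ler_norm// ler_wpM2l ?gerBl//.
  by rewrite mulr_ge0// weightA_ge0.
rewrite ler_norml upper andbT lerNl.
suff -> : - gap i j t = gap j i t by exact: upper.
by rewrite /gap -mulrN opprB.
Qed.

Lemma agreement i j : x t i 0 - x t j 0 @[t --> +oo] --> 0.
Proof.
have [c c0 bound] := gap_affine.
apply: (affine_decay delta_gt0 _ c0) (bound i j).
by rewrite mulr_ge0// weightA_ge0.
Qed.

Lemma conserved (u : 'rV[R]_n) : u *m generator = 0 ->
  h^-1 *: (x h - x 0) @[h --> 0^'+] --> generator *m x 0 ->
  forall t, 0 < t -> (u *m x t) 0 0 = (u *m x 0) 0 0.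
Proof.
move=> uM dx0; apply: derive_0_const => [t t0|].
  have dxi k := is_derive_coord k 0 (dx t0).
  rewrite (_ : (fun s => _) = fun s => \sum_k u 0 k * x s k 0); last first.
    by apply/funext => s; rewrite mxE.
  apply: is_derive_eq.
    by apply: is_derive_sumfun => k; exact: (is_deriveZ (u 0 k)).
  rewrite /GRing.scale /=; have := congr1 (fun M => (M *m x t) 0 0) uM.
  by rewrite /= -mulmxA mxE mul0mx [in RHS]mxE.
(* Differentiability at 0 from the right gives right continuity there. *)
have x0cvg : x h @[h --> 0^'+] --> x 0.
  have : h *: (h^-1 *: (x h - x 0)) + x 0 @[h --> 0^'+] --> 0 *: (generator *m x 0) + x 0.
    apply: cvgD; last exact: cvg_cst.
    by apply: cvgZ => //; exact: cvg_at_right_filter.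
  rewrite scale0r add0r; apply: cvg_trans; apply: near_eq_cvg; near=> h.
  rewrite scalerA mulfV ?scale1r ?subrK//.
rewrite mxE (_ : (fun s => _) = fun s => \sum_k u 0 k * x s k 0); last first.
  by apply/funext => s; rewrite mxE.
apply: cvg_big => [|k _]; first exact: add_continuous.
apply: cvgMl_tmp.
exact: (cvg_comp x (fun M : 'cV[R]_n => M k 0) x0cvg (@coord_continuous R n 1 k 0 (x 0))).
Unshelve. all: by end_near. Qed.

(** A coordinate [x i] differs from the constant [u *m x] by a weighted mean of the
    differences [x i - x k], because the weights [u] sum to 1. *)
Lemma consensus (u : 'rV[R]_n) : u *m generator = 0 -> \sum_k u 0 k = 1 ->
  h^-1 *: (x h - x 0) @[h --> 0^'+] --> generator *m x 0 ->
  x t @[t --> +oo] --> (u *m x 0) 0 0 *: ones R n.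
Proof.
move=> uM u1 dx0; apply: cvg_mx_coord => i j; rewrite ord1.
rewrite [X in _ --> X]mxE [ones R n _ _]mxE mulr1 -[(u *m _) _ _]add0r.
have lim_ : \sum_k u 0 k * (x t i 0 - x t k 0) + (u *m x 0) 0 0 @[t --> +oo] -->
    \sum_k u 0 k * 0 + (u *m x 0) 0 0.
  apply: cvgD; last exact: cvg_cst.
  apply: cvg_big => [|k _]; first exact: add_continuous.
  by apply: cvgMl_tmp; exact: agreement.
rewrite big1 in lim_; last by move=> k _; rewrite mulr0.
apply: cvg_trans lim_; apply: near_eq_cvg; near=> t.
have t0 : 0 < t by near: t; exact: nbhs_pinfty_gt.
rewrite -(conserved uM dx0 t0) mxE -big_split /=.
under eq_bigr do rewrite -mulrDr subrK.
by rewrite -mulr_suml u1 mul1r.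
Unshelve. all: by end_near. Qed.

End Solution.

Let N := invmx (1%:M + delta^-1 *: laplacian A).
Definition resolvent_weights : 'rV[R]_n := n%:R^-1 *: ((ones R n)^T *m N).

Lemma laplacian_ones : laplacian A *m ones R n = 0.
Proof.
apply/matrixP => i j; rewrite laplacian_mulE [RHS]mxE big1// => k _.
by rewrite !mxE subrr mulr0.
Qed.

Lemma resolvent_ones : N *m ones R n = ones R n.
Proof.
have uN := resolvent_unit A_ge0 delta_gt0.
rewrite -[in LHS](_ : (1%:M + delta^-1 *: laplacian A) *m ones R n = ones R n).
  by rewrite mulKmx.
by rewrite mulmxDl mul1mx -scalemxAl laplacian_ones scaler0 addr0.
Qed.

Lemma order_neq0 : n%:R != 0 :> R.
Proof. by rewrite pnatr_eq0 -lt0n. Qed.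

Lemma weights_ones : resolvent_weights *m ones R n = 1%:M.
Proof.
rewrite -scalemxAl -mulmxA resolvent_ones; apply/matrixP => i j.
rewrite !ord1 !mxE; under eq_bigr do rewrite !mxE mulr1.
by rewrite sumr_const card_ord mulVf ?order_neq0.
Qed.

Lemma weights_sum1 : \sum_k resolvent_weights 0 k = 1.
Proof.
have /matrixP/(_ 0 0) := weights_ones; rewrite [LHS]mxE [RHS]mxE eqxx mulr1n => <-.
by apply: eq_bigr => k _; rewrite [ones _ _ _ _]mxE mulr1.
Qed.

(** From [u *m (1 + L / delta) = 1^T / n] one gets [u *m L = delta * (1^T / n - u)],
    and [u *m 1 = 1] gives [u *m K = u - 1^T / n]: the two parts cancel. *)
Lemma weights_generator : resolvent_weights *m generator = 0.
Proof.
have uN := resolvent_unit A_ge0 delta_gt0.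
have uL : resolvent_weights *m (1%:M + delta^-1 *: laplacian A) =
    n%:R^-1 *: (ones R n)^T.
  by rewrite -scalemxAl mulmxKV.
have {}uL : resolvent_weights *m laplacian A =
    delta *: (n%:R^-1 *: (ones R n)^T - resolvent_weights).
  rewrite -uL [in RHS]mulmxDr mulmx1 addrC addKr -scalemxAr scalerA mulfV ?scale1r//.
  exact: lt0r_neq0.
rewrite mulmxN mulmxDr uL -scalemxAr mulmxBr mulmx1 -scalemxAr mulmxA.
by rewrite weights_ones mul1mx -scalerDr addrC subrKA subrr scaler0 oppr0.
Qed.

Lemma weightsE (v : 'cV[R]_n) :
  (resolvent_weights *m v) 0 0 = n%:R^-1 * \sum_j colsum N j * v j 0.
Proof.
rewrite -scalemxAl mxE; congr (_ * _); rewrite mxE; apply: eq_bigr => j _.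
by congr (_ * _); rewrite mxE; apply: eq_bigr => i _; rewrite !mxE mul1r.
Qed.

End Consensus.

Theorem corollary4p3 (R : realType) (n : nat) (n_gt0 : (0 < n)%N)
    (A : 'M[R]_n) (A_ge0 : forall i j, 0 <= A i j) :
  (forall (delta : R) (x : R -> 'cV[R]_n),
     0 < delta ->
     solves_linear_ode (- (laplacian A + delta *: Kmx R n)) x ->
     1%:M + delta^-1 *: laplacian A \in unitmx /\
     x t @[t --> +oo] -->
       (n%:R^-1 *
        \sum_(j < n)
          colsum (invmx (1%:M + delta^-1 *: laplacian A)) j * x 0 j ord0)
       *: ones R n)
  /\
  (forall (x0 : 'cV[R]_n) (x : R -> R -> 'cV[R]_n),
     (forall delta : R, 0 < delta ->
        solves_linear_ode (- (laplacian A + delta *: Kmx R n)) (x delta) /\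
        x delta 0 = x0) ->
     lim (x delta t @[t --> +oo]) @[delta --> 0^'+] -->
       (n%:R^-1 * \sum_(j < n) colsum (Jbar A) j * x0 j ord0) *: ones R n).
Proof.
split=> [delta x d0 [dx dx0]|x0 x xP].
  split; first exact: resolvent_unit.
  rewrite -(weightsE A delta).
  exact: (consensus A_ge0 d0 dx (weights_generator n_gt0 A_ge0 d0)
    (weights_sum1 n_gt0 A_ge0 d0) dx0).
(* The value of the inner limit, as given by the first part. *)
pose w (delta : R) :=
  n%:R^-1 * \sum_(j < n)
    colsum (invmx (1%:M + delta^-1 *: laplacian A)) j * x0 j ord0.
have wlim : w delta *: ones R n @[delta --> 0^'+] -->
    (n%:R^-1 * \sum_(j < n) colsum (Jbar A) j * x0 j ord0) *: ones R n.
  apply: cvgZr_tmp; apply: cvgMl_tmp.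
  apply: cvg_big => [|j _]; first exact: add_continuous.
  apply: cvgMr_tmp; apply: cvg_big => [|i _]; first exact: add_continuous.
  exact: resolvent_cvg.
apply: cvg_trans wlim; apply: near_eq_cvg; near=> delta.
have d0 : 0 < delta by near: delta; exact: nbhs_right_gt.
have [[dx dx0] x0E] := xP delta d0.
apply/esym/cvg_lim; first exact: norm_hausdorff.
rewrite /w -x0E -(weightsE A delta).
exact: (consensus A_ge0 d0 dx (weights_generator n_gt0 A_ge0 d0)
  (weights_sum1 n_gt0 A_ge0 d0) dx0).
Unshelve. all: by end_near. Qed.
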